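(* Let $X$ be a real or complex Banach space with dual $X^*$. Let $(T_n)_{n\ge0}$ be a sequence of bounded, finite-rank linear operators on $X$ such that \[ T_nT_m(X)\subset T_m(X)\quad\text{and}\quad T_n^*T_m^*(X^* )\subset T_m^*(X^* )\qquad(m,n\ge0). \] Let $Y$ be the norm-closure in $X$ of $\operatorname{span}\bigl(\bigcup_{m\ge0}T_m(X)\bigr)$ and let $Z$ be the norm-closure in $X^*$ of $\operatorname{span}\bigl(\bigcup_{m\ge0}T_m^*(X^* )\bigr)$. Then the following are equivalent: (i) $T_nx\to x$ weakly in $X$ for all $x\in X$; (ii) $T_nx\to x$ in norm for all $x\in X$; (iii) $T_n^*\phi\to\phi$ in the weak* topology of $X^*$ for all $\phi\in X^*$; (iv) $T_n^*\phi\to\phi$ weak* for all $\phi\in Z$, and $Z$ is weak*-sequentially dense in $X^*$, and $Y=X$; (v) $T_n^*\phi\to\phi$ in norm for all $\phi\in Z$, and $Z$ is weak*-sequentially dense in $X^*$, and $Y=X$. If moreover $X$ is reflexive, these are also equivalent to: (vi) $T_n^*\phi\to\phi$ in norm for all $\phi\in X^*$.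
   Context: $T^*$ denotes the Banach-space adjoint of a bounded operator $T$ on $X$, defined by $\langle x,T^*\phi\rangle=\langle Tx,\phi\rangle$ for $x\in X,\phi\in X^*$, where $\langle\cdot,\cdot\rangle$ is the duality pairing between $X$ and $X^*$. *)

(* Defs.v *)
From HB Require Import structures.
From mathcomp Require Import all_boot all_order all_algebra.
From mathcomp Require Import all_classical all_reals all_analysis.
From mathcomp Require Export complex.
Export numFieldTopology.Exports numFieldNormedType.Exports.
Import Order.TTheory GRing.Theory Num.Theory.

Set Implicit Arguments.
Unset Strict Implicit.
Unset Printing Implicit Defensive.

Local Open Scope ring_scope.
Local Open Scope classical_set_scope.

Section Defs.
Variables (K : numFieldType) (X : normedModType K).

Definition is_dual (f : X -> K) : Prop :=
  (forall (a : K) (x y : X), f (a *: x + y) = a * f x + f y) /\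
  (exists C : K, forall x : X, `|f x| <= C * `|x|).

Definition bounded_linear (T : X -> X) : Prop :=
  (forall (a : K) (x y : X), T (a *: x + y) = a *: T x + T y) /\
  (exists C : K, forall x : X, `|T x| <= C * `|x|).

Definition finite_rank (T : X -> X) : Prop :=
  exists (n : nat) (v : 'I_n -> X),
    forall x : X, exists c : 'I_n -> K, T x = \sum_(i < n) c i *: v i.

Definition adj (T : X -> X) (phi : X -> K) : X -> K := phi \o T.

Definition spanX (A : set X) : set X :=
  [set v | exists (n : nat) (w : 'I_n -> X) (c : 'I_n -> K),
     (forall i, A (w i)) /\ v = \sum_(i < n) c i *: w i].

Definition spanD (A : set (X -> K)) : set (X -> K) :=
  [set psi | exists (n : nat) (g : 'I_n -> (X -> K)) (c : 'I_n -> K),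
     (forall i, A (g i)) /\ psi = (fun x => \sum_(i < n) c i * g i x)].

(* dual-norm ball condition: || phi - psi ||_{X^*} <= e *)
Definition dual_dist_le (phi psi : X -> K) (e : K) : Prop :=
  forall x : X, `|phi x - psi x| <= e * `|x|.

Definition dual_closure (A : set (X -> K)) : set (X -> K) :=
  [set phi | is_dual phi /\
     forall e : K, 0 < e -> exists psi, A psi /\ dual_dist_le phi psi e].

Definition dual_norm_cvg (u : nat -> X -> K) (phi : X -> K) : Prop :=
  forall e : K, 0 < e -> \forall n \near \oo, dual_dist_le (u n) phi e.

Definition weakstar_cvg (u : nat -> X -> K) (phi : X -> K) : Prop :=
  forall x : X, (fun n => u n x) @ \oo --> phi x.

Definition weak_cvg (u : nat -> X) (x : X) : Prop :=
  forall f : X -> K, is_dual f -> (fun n => f (u n)) @ \oo --> f x.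

Definition weakstar_seq_dense (A : set (X -> K)) : Prop :=
  forall phi, is_dual phi ->
    exists u : nat -> X -> K, (forall n, A (u n)) /\ weakstar_cvg u phi.

Definition reflexive : Prop :=
  forall Phi : (X -> K) -> K,
    (forall (a : K) phi psi, is_dual phi -> is_dual psi ->
        Phi (fun x => a * phi x + psi x) = a * Phi phi + Phi psi) ->
    (exists C : K, forall phi (c : K), is_dual phi ->
        (forall x, `|phi x| <= c * `|x|) -> `|Phi phi| <= C * c) ->
    exists x : X, forall phi, is_dual phi -> Phi phi = phi x.

Definition Yspace (T : nat -> X -> X) : set X :=
  closure (spanX [set y | exists m, range (T m) y]).

Definition Zspace (T : nat -> X -> X) : set (X -> K) :=
  dual_closure (spanD [set psi | exists m phi, is_dual phi /\ psi = adj (T m) phi]).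

Definition theorem2p1_statement : Prop :=
  forall T : nat -> X -> X,
    (forall n, bounded_linear (T n)) ->
    (forall n, finite_rank (T n)) ->
    (forall m n x, exists y, T n (T m x) = T m y) ->
    (forall m n phi, is_dual phi ->
        exists psi, is_dual psi /\ adj (T n) (adj (T m) phi) = adj (T m) psi) ->
    let c1 := forall x, weak_cvg (fun n => T n x) x in
    let c2 := forall x, (fun n => T n x) @ \oo --> x in
    let c3 := forall phi, is_dual phi -> weakstar_cvg (fun n => adj (T n) phi) phi in
    let c4 := (forall phi, Zspace T phi -> weakstar_cvg (fun n => adj (T n) phi) phi)
              /\ weakstar_seq_dense (Zspace T) /\ Yspace T = setT in
    let c5 := (forall phi, Zspace T phi -> dual_norm_cvg (fun n => adj (T n) phi) phi)
              /\ weakstar_seq_dense (Zspace T) /\ Yspace T = setT in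
    let c6 := forall phi, is_dual phi -> dual_norm_cvg (fun n => adj (T n) phi) phi in
    (c1 <-> c2) /\ (c1 <-> c3) /\ (c1 <-> c4) /\ (c1 <-> c5) /\
    (reflexive -> (c1 <-> c6)).

End Defs.

(* Main.v *)
Require Import Defs.
From HB Require Import structures.
From mathcomp Require Import all_boot all_order all_algebra.
From mathcomp Require Import all_classical all_reals all_analysis.
From mathcomp Require Import complex ring lra.
Import Order.TTheory GRing.Theory Num.Theory.
Set Implicit Arguments.
Unset Strict Implicit.
Unset Printing Implicit Defensive.
Local Open Scope ring_scope.
Local Open Scope classical_set_scope.

(** Weak convergence [T_n x --> x] makes [(T_n)] uniformly bounded, by the
    uniform boundedness principle on [X] and on [X^*]. On the range of [T_m],
    which is finite-dimensional and invariant under every [T_n], weak and norm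
    convergence agree; by uniform boundedness this extends to the closed span
    [Y] of the ranges, and [Y] is all of [X] by Hahn-Banach. The same argument
    for the adjoints, whose ranges are also finite-dimensional and invariant,
    gives norm convergence on [Z].

    Conversely, under (iv) the uniform boundedness principle on the Banach space
    [Z], followed by a passage to the limit along a weak*-convergent sequence of
    [Z], makes [phi (T_n x)] bounded in [n] for every [phi] in [X^*]; since [Z]
    separates points, the first argument applies again. If [X] is reflexive, a
    functional outside [Z] would be separated from [Z] by an evaluation at a
    point, contradicting the weak* density of [Z].

    Everything is done over a [numFieldType] [K] that is Archimedean, Cauchy
    complete and satisfies Hahn-Banach, which covers both [R] and [R[i]]. *)

(** * Hahn-Banach theorem *)

(* [N v c] reads "the gauge of [v] is at most [c]". The gauge may be infinite:
   [N v] may be empty, which allows a norm defined on a subspace only. *)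
Definition is_gauge (K : numFieldType) (V : lmodType K) (N : V -> K -> Prop)
    : Prop :=
  [/\ forall v c, N v c -> 0 <= c, N 0 0,
      forall v w c d, N v c -> N w d -> N (v + w) (c + d) &
      forall a v c, N v c -> N (a *: v) (`|a| * c)].

Definition lin (K : numFieldType) (V W : lmodType K) (f : V -> W) : Prop :=
  forall a x y, f (a *: x + y) = a *: f x + f y.

Section LinLemmas.
Variables (K : numFieldType) (V W : lmodType K) (f : V -> W).
Hypothesis fl : lin f.

Lemma lin0 : f 0 = 0.
Proof.
by have := fl (-1) 0 0; rewrite scaleN1r addr0 scaleN1r oppr0 addNr.
Qed.

Lemma linZ a x : f (a *: x) = a *: f x.
Proof. by have := fl a x 0; rewrite lin0 !addr0. Qed.

Lemma linD x y : f (x + y) = f x + f y.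
Proof. by have := fl 1 x y; rewrite !scale1r. Qed.

Lemma linB x y : f (x - y) = f x - f y.
Proof. by rewrite linD -scaleN1r linZ scaleN1r. Qed.

Lemma lin_sum (n : nat) (c : 'I_n -> K) (v : 'I_n -> V) :
  f (\sum_(i < n) c i *: v i) = \sum_(i < n) c i *: f (v i).
Proof.
elim: n c v => [|n IH] c v; first by rewrite !big_ord0 lin0.
by rewrite !big_ord_recr /= linD linZ IH.
Qed.

End LinLemmas.

(** A property of the scalar field, so that later arguments treat the real and complex cases
    together. Asking only for [e <= |f x0|] suits the complex case, where the construction fixes
    just the real part of [f x0]. *)
Definition hahn_banach (K : numFieldType) : Prop :=
  forall (V : lmodType K) (N : V -> K -> Prop), is_gauge N ->
  forall (x0 : V) (e : K), 0 <= e -> (forall c, N x0 c -> e <= c) ->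
  exists f : V -> K, [/\ lin (f : V -> K^o),
    forall v c, N v c -> `|f v| <= c & e <= `|f x0|].

(** * The real case, by Zorn's lemma *)

Section RealHB.
Variables (R : realType) (V : lmodType R) (N : V -> R -> Prop).
Hypothesis gN : is_gauge N.

(* Partial functionals are represented by their graphs; since [N 0 0] holds,
   domination forces a graph to be single-valued. *)
Definition dominated_graph (G : set (V * R)) : Prop :=
  [/\ forall a p q, G p -> G q -> G (a *: p.1 + q.1, a * p.2 + q.2) &
      forall p c, G p -> N p.1 c -> p.2 <= c].

Lemma dominated_graph_line (x0 : V) (e : R) : 0 <= e ->
  (forall c, N x0 c -> e <= c) ->
  dominated_graph [set p | exists t, p = (t *: x0, t * e)].
Proof.
have [N0 _ _ NZ] := gN.
move=> e0 ex; split.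
- move=> a _ _ [t ->] [s ->] /=; exists (a * t + s).
  by rewrite scalerDl scalerA mulrDl mulrA.
- move=> _ c [t ->] /= Nc; have [t0|t0] := leP t 0.
    by apply: (@le_trans _ _ 0); [nra | exact: N0 Nc].
  have := NZ t^-1 _ _ Nc; rewrite scalerA mulVf ?gt_eqF// scale1r => /ex.
  by rewrite gtr0_norm ?invr_gt0// mulrC ler_pdivlMr// mulrC.
Qed.

(** The triangle inequality puts every lower constraint [w.2 - c] on the value at [v0] below every
    upper constraint [c - w.2]. Any [a] in between works, since homogeneity reduces the coefficient
    of [v0] to 1 or -1. *)
Lemma dominated_graph_extend (G : set (V * R)) (v0 : V) :
  dominated_graph G -> G !=set0 ->
  exists a, dominated_graph
    [set p | exists w t, G w /\ p = (w.1 + t *: v0, w.2 + t * a)].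
Proof.
have [N0 N00 ND NZ] := gN.
move=> [Glin Gdom] [p0 Gp0].
have G0 : G (0, 0).
  by have := Glin (-1) _ _ Gp0 Gp0; rewrite scaleN1r mulN1r !addNr.
have GZ a p : G p -> G (a *: p.1, a * p.2).
  by move=> Gp; have := Glin a _ _ Gp G0; rewrite !addr0.
pose L := [set x | exists w c, [/\ G w, N (w.1 - v0) c & x = w.2 - c]].
have LU w c x : G w -> N (w.1 + v0) c -> L x -> x <= c - w.2.
  move=> Gw Nw [w' [c' [Gw' Nw' ->]]].
  have := ND _ _ _ _ Nw Nw'; rewrite addrACA subrr addr0.
  have := Glin 1 _ _ Gw Gw'; rewrite scale1r mul1r => /Gdom/[apply] /=; lra.
have [a aL aU] : exists2 a, (forall x, L x -> x <= a) &
    (forall w c, G w -> N (w.1 + v0) c -> a <= c - w.2).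
  (* An infinite gauge may leave no constraint at all: an upper constraint at [w] gives a lower one
     at [-w], so if [L] is empty there is no upper constraint either and 0 serves. *)
  have [L0|] := pselect (L !=set0).
    exists (sup L).
      move=> x Lx; apply: ub_le_sup => //.
      have [_ [w [c [Gw Nw _]]]] := L0.
      have := NZ (-1) _ _ Nw; rewrite normrN1 mul1r scaleN1r opprB => Nw'.
      have := GZ (-1) _ Gw; rewrite scaleN1r mulN1r => Gw'.
      exists (c + w.2) => y Ly.
      by have := LU _ c _ Gw'; rewrite /= addrC opprK; apply.
    move=> w c Gw Nw; apply: ge_sup => // x Lx; exact: LU.
  move=> L0; exists 0 => [x Lx|w c Gw Nw].
    by exfalso; apply: L0; exists x.
  exfalso; apply: L0; exists (- w.2 - c), (- w.1, - w.2), c; split => //=.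
    by have := GZ (-1) _ Gw; rewrite scaleN1r mulN1r.
  by have := NZ (-1) _ _ Nw; rewrite normrN1 mul1r scaleN1r opprD.
exists a; split.
  move=> b _ _ [w [t [Gw ->]]] [w' [t' [Gw' ->]]] /=.
  exists (b *: w.1 + w'.1, b * w.2 + w'.2), (b * t + t').
  split; first exact: Glin.
  congr pair => /=; last by ring.
  by rewrite scalerDr scalerA addrACA -scalerDl.
move=> _ c [w [t [Gw ->]]] /= Nc.
have [t0|t0|t0] := ltgtP t 0; last first.
- by move: Nc; rewrite t0 scale0r mul0r !addr0; exact: Gdom.
- have := NZ t^-1 _ _ Nc; rewrite scalerDr scalerA mulVf ?gt_eqF// scale1r.
  rewrite gtr0_norm ?invr_gt0// => /(aU (t^-1 *: w.1, t^-1 * w.2)) /=.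
  move=> /(_ (GZ _ _ Gw)); rewrite -mulrBr ler_pdivlMl//; lra.
- have s0 : 0 < - t by lra.
  have := NZ (- t)^-1 _ _ Nc.
  rewrite scalerDr scalerA invrN mulNr mulVf ?lt_eqF// scaleN1r.
  rewrite -invrN gtr0_norm ?invr_gt0// => Nc'.
  have : L ((- t)^-1 * w.2 - (- t)^-1 * c).
    exists ((- t)^-1 *: w.1, (- t)^-1 * w.2), ((- t)^-1 * c).
    by split => //; exact: GZ.
  move=> /aL; rewrite -mulrBr ler_pdivrMl//; lra.
Qed.

Lemma real_hahn_banach (x0 : V) (e : R) : 0 <= e ->
  (forall c, N x0 c -> e <= c) ->
  exists f : V -> R, [/\ lin (f : V -> R^o),
    forall v c, N v c -> `|f v| <= c & f x0 = e].
Proof.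
have [N0 N00 ND NZ] := gN.
move=> e0 ex.
pose G0 := [set p : V * R | exists t, p = (t *: x0, t * e)].
(* Conditional on nonemptiness, because the empty chain has an empty union, which must satisfy
   [P]. *)
pose P G := G !=set0 -> dominated_graph G /\ G0 `<=` G.
have [] := @Zorn_bigcup _ P.
  move=> F FP Ftot [p0 [A0 FA0 Ap0]]; split; last first.
    by move=> p G0p; exists A0 => //; have [|_] := FP _ FA0; [exists p0|apply].
  have FD A p : F A -> A p -> dominated_graph A.
    by move=> /FP FA Ap; apply FA; exists p.
  split; last first.
    by move=> p c [A FA Ap]; have [_] := FD _ _ FA Ap; apply.
  move=> a p q [A FA Ap] [B FB Bq].
  have [AB|BA] := Ftot _ _ FA FB.
    by exists B => //; have [+ _] := FD _ _ FB Bq; apply=> //; exact: AB.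
  by exists A => //; have [+ _] := FD _ _ FA Ap; apply=> //; exact: BA.
move=> G [PG Gmax].
have dG0 := dominated_graph_line e0 ex.
have Gn : G !=set0.
  apply/set0P/eqP => G0e; apply: (Gmax G0); last by move=> _; split.
  by rewrite G0e; split=> // /(_ (0 *: x0, 0 * e)); apply; exists 0.
have [dG G0G] := PG Gn; have [Glin Gdom] := dG.
have Gx0 : G (x0, e) by apply: G0G; exists 1; rewrite scale1r mul1r.
have G00 : G (0, 0) by apply: G0G; exists 0; rewrite scale0r mul0r.
have Gtot v : exists r, G (v, r).
  have [a dGa] := dominated_graph_extend v dG Gn.
  set G' := (X in dominated_graph X) in dGa.
  have GG' : G `<=` G'.
    move=> [w r] Gw; exists (w, r), 0; split => //.
    by rewrite scale0r mul0r !addr0.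
  have G'G : G' `<=` G.
    have [//|nG'] := pselect (G' `<=` G).
    exfalso; apply: (Gmax G'); first by [].
    by split => //; apply: subset_trans GG'.
  by exists a; apply: G'G; exists (0, 0), 1; rewrite /= scale1r mul1r !add0r.
have [f Gf] := choice Gtot.
have Gle r s v : G (v, r) -> G (v, s) -> r <= s.
  move=> Gr Gs; have := Glin (-1) _ _ Gs Gr; rewrite /= scaleN1r addNr mulN1r.
  by move=> /Gdom /(_ N00) /=; lra.
have Guniq r s v : G (v, r) -> G (v, s) -> r = s.
  by move=> Gr Gs; apply: le_anti; rewrite (Gle _ _ _ Gr Gs) (Gle _ _ _ Gs Gr).
have fl a x y : f (a *: x + y) = a * f x + f y.
  by apply: Guniq (Gf _) _; exact: (Glin a _ _ (Gf x) (Gf y)).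
exists f; split => //; last exact: Guniq (Gf _) Gx0.
move=> v c Nv; rewrite ler_norml (Gdom _ _ (Gf v) Nv) andbT.
have f0 : f 0 = 0 by exact: Guniq (Gf _) G00.
have := NZ (-1) _ _ Nv; rewrite normrN1 mul1r => /(Gdom _ _ (Gf _)) /=.
by have := fl (-1) v 0; rewrite addr0 => ->; rewrite f0; lra.
Qed.

End RealHB.

Lemma hahn_banach_real (R : realType) : hahn_banach R.
Proof.
move=> V N gN x0 e e0 ex.
have [f [fl fN fx]] := real_hahn_banach gN e0 ex.
by exists f; split=> //; rewrite fx ler_norm.
Qed.

(** * The complex case, by restriction of scalars *)

Definition restrict_scalars (R : realType) (V : lmodType R[i]) : Type := V.

Section RestrictScalars.
Variables (R : realType) (V : lmodType R[i]).
Local Open Scope complex_scope.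

HB.instance Definition _ := GRing.Zmodule.on (restrict_scalars V).

Let rscale (a : R) (v : restrict_scalars V) : restrict_scalars V :=
  a%:C *: (v : V).

Let rscaleA a b v : rscale a (rscale b v) = rscale (a * b) v.
Proof. by rewrite /rscale scalerA rmorphM. Qed.

Let rscale1 : left_id 1 rscale.
Proof. by move=> v; rewrite /rscale rmorph1 scale1r. Qed.

Let rscaleDr : right_distributive rscale +%R.
Proof. by move=> a v w; rewrite /rscale scalerDr. Qed.

Let rscaleDl v : {morph rscale^~ v : a b / a + b}.
Proof. by move=> a b; rewrite /rscale rmorphD scalerDl. Qed.

HB.instance Definition _ := GRing.Zmodule_isLmodule.Build R
  (restrict_scalars V) rscaleA rscale1 rscaleDr rscaleDl.

Lemma restrict_scalarsE (a : R) (v : V) :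
  a *: (v : restrict_scalars V) = a%:C *: v.
Proof. by []. Qed.

End RestrictScalars.

Section ComplexHB.
Variable R : realType.
Local Open Scope complex_scope.

Lemma normC_Re (z : R[i]) : `|z| = (complex.Re `|z|)%:C.
Proof. by rewrite RRe_real ?normr_real. Qed.

Lemma complex_phase (z : R[i]) : exists2 w : R[i], `|w| = 1 & w * z = `|z|.
Proof.
have [->|z0] := eqVneq z 0; first by exists 1; rewrite ?normr1 // mulr0 normr0.
have nz : `|z| != 0 by rewrite normr_eq0.
exists (`|z| / z); first by rewrite normrM normrV ?unitfE// normr_id divff.
by rewrite mulfVK.
Qed.

(* A real functional [u] is the real part of the complex functional
   [v |-> u v - i u (i v)]. *)
Lemma hahn_banach_complex : hahn_banach R[i].
Proof.
move=> V N [N0 N00 ND NZ] x0 e e0 ex.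
pose V' := restrict_scalars V.
pose N' (v : V') (c : R) := N v c%:C.
have eE : (complex.Re e)%:C = e by rewrite RRe_real ?ger0_real.
have gN' : is_gauge N'.
  split.
  - by move=> v c /N0; rewrite ler0c.
  - exact: N00.
  - by move=> v w c d Nv Nw; rewrite /N' rmorphD; exact: ND.
  - move=> a v c Nv; rewrite /N' restrict_scalarsE rmorphM.
    have := NZ a%:C _ _ Nv; congr (N _ (_ * _)).
    by rewrite normc_def /= expr0n addr0 sqrtr_sqr.
have [|c Nc|u [ulin uN ux]] := @real_hahn_banach R V' N' gN' x0 (complex.Re e).
- by rewrite -ler0c eE.
- by rewrite -lecR eE; exact: ex.
have ul a x y : u (a *: x + y) = a * u x + u y := ulin a x y.
have uD x y : u (x + y) = u x + u y by have := ul 1 x y; rewrite scale1r mul1r.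
have u0 : u 0 = 0 by have := uD 0 0; rewrite addr0; lra.
have uZ a x : u (a%:C *: (x : V)) = a * u x.
  by have := ul a x 0; rewrite !addr0 u0 addr0.
pose f (v : V) : R[i] := u v +i* (- u ('i *: v)).
have fE z : (complex.Re (f z)) = u z by [].
have uc a b (x : V) : u ((a +i* b) *: x) = a * u x + b * u ('i *: x).
  have -> : a +i* b = a%:C + b%:C * 'i by simpc.
  by rewrite scalerDl uD uZ -scalerA uZ.
have flin : lin (f : V -> R[i]^o).
  move=> [a b] x y; rewrite /f scalerDr scalerA !uD.
  have -> : 'i * (a +i* b) = (- b) +i* a by simpc.
  have cE (p q r s : R) : (a +i* b) *: (p +i* q : R[i]^o) + (r +i* s)
    = (a * p - b * q + r) +i* (a * q + b * p + s) by [].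
  by rewrite (uc a b x) (uc (- b) a x) cE; congr (_ +i* _); ring.
exists f; split; first exact: flin.
- move=> v c Nv; have c0 := N0 _ _ Nv.
  have cE : c = (complex.Re c)%:C by rewrite RRe_real ?ger0_real.
  (* Rotating [v] by a unit scalar makes [f (w *: v)] equal to [|f v|], hence real and equal to
     [u (w *: v)], which the real bound controls. *)
  have [w w1 wE] := complex_phase (f v).
  have := NZ w _ _ Nv; rewrite w1 mul1r {1}cE => /(uN _ _) uw.
  rewrite normC_Re cE lecR; apply: le_trans uw.
  have fw : f (w *: v) = `|f v| by rewrite (linZ flin) -wE.
  by rewrite -fw fE ler_norm.
- have : complex.Re (f x0) = complex.Re e by rewrite fE.
  move=> Rf; rewrite -eE -Rf normc_def lecR.
  apply: (le_trans (ler_norm _)).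
  by rewrite -sqrtr_sqr ler_wsqrtr// lerDl sqr_ge0.
Qed.

End ComplexHB.

(** * Uniform boundedness principle *)

Definition archimedean_scalars (K : numFieldType) : Prop :=
  forall x : K, 0 <= x -> exists n : nat, x <= n%:R.

(** The order of a [numFieldType] is partial, but positive elements are comparable. *)
Lemma exists_pos_lower_bound (K : numFieldType) (a b : K) : 0 < a -> 0 < b ->
  exists s, [/\ 0 < s, s <= a & s <= b].
Proof.
move=> a0 b0; have /orP[ab|ba] := real_leVge (gtr0_real a0) (gtr0_real b0).
  by exists a.
by exists b.
Qed.

(* [B v c] plays the role of [`|v| <= c]; this relational form applies to dual
   spaces without constructing the dual norm. *)
Section UniformBoundedness.
Variables (K : numFieldType) (V : lmodType K) (D : set V) (B : V -> K -> Prop).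
Hypothesis archK : archimedean_scalars K.
Hypothesis D0 : D 0.
Hypothesis Dlin : forall a x y, D x -> D y -> D (a *: x + y).
Hypothesis BZ : forall a v c, B v c -> B (a *: v) (`|a| * c).
(** Completeness, asked only of centres of nested balls whose radii at least halve; the limit lies
    in all the balls. *)
Hypothesis Bcomplete : forall (x : nat -> V) (r : nat -> K),
  (forall n, D (x n)) -> (forall n, 0 < r n) ->
  (forall n, r n.+1 <= r n / 2) -> (forall n, B (x n.+1 - x n) (r n / 2)) ->
  exists2 l, D l & forall n, B (l - x n) (r n).
Variables (I : Type) (q : I -> V -> K).
Hypothesis q0 : forall i v, 0 <= q i v.
Hypothesis qD : forall i v w, q i (v + w) <= q i v + q i w.
Hypothesis qZ : forall i a v, q i (a *: v) = `|a| * q i v.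
Hypothesis qB : forall i, exists2 C, 0 <= C &
  forall v c, D v -> B v c -> q i v <= C * c.
Hypothesis pointwise : forall v, D v -> exists M, forall i, q i v <= M.

Let qN i v : q i (- v) = q i v.
Proof. by rewrite -scaleN1r qZ normrN1 mul1r. Qed.

Let bounded_on_balls (M : K) : Prop :=
  forall i v c, D v -> 0 < c -> B v c -> q i v <= M * c.

(** Without a uniform bound some [q i] is large on a vector that can be scaled to size [r / 2].
    Adding it to [x] gives a point where [q i] exceeds [M + 1], and continuity of [q i] gives a ball
    where it exceeds [M]. *)
Let large_on_subball (x : V) (r M : K) :
  ~ (exists2 M, 0 <= M & bounded_on_balls M) -> D x -> 0 < r -> 0 <= M ->
  exists y s, [/\ D y, 0 < s, s <= r / 2, B (y - x) (r / 2) &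
    exists i, forall v, D v -> B (v - y) s -> M < q i v].
Proof.
move=> nb Dx r0 M0; have [Mx qx] := pointwise Dx.
have r20 : 0 < r / 2 by rewrite divr_gt0.
(* [|Mx|] absorbs [q i x] in passing from [y - x] to [y]; the 1 absorbs the variation of [q i] on
   the ball of radius at most [1 / (C + 1)] around [y]. *)
pose A := M + 1 + `|Mx|.
have A0 : 0 <= A by rewrite !addr_ge0.
have [i [v [c [Dv c0 Bv qv]]]] :
    exists i v c, [/\ D v, 0 < c, B v c & ~ (q i v <= (A / (r / 2)) * c)].
  apply: contrapT => H; apply: nb; exists (A / (r / 2)).
    by rewrite divr_ge0// ltW.
  move=> i v c Dv c0 Bv; apply: contrapT => qv; apply: H.
  by exists i, v, c; split.
have {qv} : (A / (r / 2)) * c < q i v.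
  rewrite real_ltNge; first exact/negP.
    by rewrite ger0_real// mulr_ge0 ?divr_ge0// ltW.
  by rewrite ger0_real.
move=> qv; pose a := r / 2 / c.
have a0 : 0 < a by rewrite divr_gt0.
pose y := a *: v + x.
have yx : y - x = a *: v by rewrite /y addrK.
have qy : M + 1 < q i y.
  have : A < a * q i v.
    rewrite -ltr_pdivrMl//; have -> // : a^-1 * A = A / (r / 2) * c.
    by rewrite /a; field; rewrite !gt_eqF.
  have -> : a * q i v = q i (y - x) by rewrite yx qZ gtr0_norm.
  move=> Aq; have := lt_le_trans Aq (qD _ _ _); rewrite qN => {}Aq.
  rewrite -(ltrD2r `|Mx|); apply: lt_le_trans Aq _; rewrite lerD2l.
  apply: le_trans (qx i) _.
  by rewrite real_ler_norm// ger0_real// (le_trans (q0 i x)).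
have [C C0 qC] := qB i.
have C10 : 0 < (C + 1)^-1 by rewrite invr_gt0 ltr_wpDl.
have [s [s0 sr sC]] := exists_pos_lower_bound r20 C10.
exists y, s; split=> //.
- exact: Dlin.
- rewrite yx; have := BZ a Bv; rewrite gtr0_norm// /a.
  by rewrite mulfVK// gt_eqF.
exists i => w Dw Bw; rewrite -(ltrD2r 1); apply: lt_le_trans qy _.
have -> : y = w + (y - w) by rewrite addrC subrK.
apply: le_trans (qD _ _ _) _; rewrite lerD2l -qN opprB.
have Dwy : D (w - y).
  by rewrite -scaleN1r addrC; apply: Dlin => //; exact: Dlin.
apply: (le_trans (qC _ _ Dwy Bw)).
apply: (@le_trans _ _ (C * (C + 1)^-1)); first exact: ler_wpM2l.
by rewrite ler_pdivrMr ?ltr_wpDl// mul1r lerDl.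
Qed.

(** Iterating the previous step gives nested balls, the [n]-th step making some [q i] exceed [n].
    Their common point contradicts pointwise boundedness. *)
Lemma uniform_boundedness : exists2 M, 0 <= M &
  forall i v c, D v -> 0 < c -> B v c -> q i v <= M * c.
Proof.
apply: contrapT => nb.
(* The conditions on the current ball sit under the existential, with a dummy witness when they
   fail, so that [choice] yields a total step function. *)
have step (p : nat * (V * K)) : exists z : V * K, D p.2.1 -> 0 < p.2.2 ->
    [/\ D z.1, 0 < z.2, z.2 <= p.2.2 / 2, B (z.1 - p.2.1) (p.2.2 / 2) &
    exists i, forall v, D v -> B (v - z.1) z.2 -> p.1%:R < q i v].
  have [[Dx r0]|np] := pselect (D p.2.1 /\ 0 < p.2.2); last first.
    by exists p.2 => Dx r0; case: np.
  have [y [s ys]] := @large_on_subball p.2.1 p.2.2 p.1%:R nb Dx r0 (ler0n _ _).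
  by exists (y, s).
have [F FP] := choice step.
pose z := fix z n := if n is n'.+1 then F (n', z n') else (0 : V, 1 : K).
have zP n : D (z n).1 /\ 0 < (z n).2.
  elim: n => [|n [Dx r0]]; first by split=> //=; exact: ltr01.
  by have [] := FP (n, z n) Dx r0.
have zS n := FP (n, z n) (zP n).1 (zP n).2.
have [l Dl Bl] : exists2 l, D l & forall n, B (l - (z n).1) (z n).2.
  apply: Bcomplete => n.
  - by have [] := zP n.
  - by have [] := zP n.
  - by have [] := zS n.
  - by have [] := zS n.
have [M qM] := pointwise Dl.
have ql n : exists i, n%:R < q i l.
  have [_ _ _ _ [i qi]] := zS n; exists i; apply: qi => //.
  exact: (Bl n.+1).
have [i0 qi0] := ql 0%N.
have [n Mn] := archK (le_trans (ltW qi0) (qM i0)).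
have [i qi] := ql n.
by have := lt_le_trans qi (le_trans (qM i) Mn); rewrite ltxx.
Qed.

End UniformBoundedness.

(** * Coordinates on finite-dimensional spaces *)

Section FiniteCoordinates.
Variables (K : numFieldType) (V : lmodType K).
(** Keeping the separating family [S] abstract lets coordinates be drawn from the dual, from
    [Zspace], or from the functionals along which a given sequence converges. *)
Variables (E : set V) (S : set (V -> K)).
Hypothesis E0 : E 0.
Hypothesis Elin : forall a x y, E x -> E y -> E (a *: x + y).
Hypothesis S0 : S (fun=> 0).
Hypothesis Scomb : forall a f g, S f -> S g -> S (fun x => a * f x + g x).
Hypothesis Slin : forall f, S f -> lin (f : V -> K^o).
Hypothesis Ssep : forall x, E x -> (forall f, S f -> f x = 0) -> x = 0.

Lemma comb_sum_closed m (e : nat -> V) (c : nat -> K) :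
  (forall j, E (e j)) -> E (\sum_(j < m) c j *: e j).
Proof.
move=> Ee; elim: m => [|m IH]; first by rewrite big_ord0.
by rewrite big_ord_recr /= addrC; exact: Elin.
Qed.

Lemma functional_sum_closed m (f : nat -> V -> K) (c : nat -> K) :
  (forall j, S (f j)) -> S (fun x => \sum_(j < m) c j * f j x).
Proof.
move=> Sf; elim: m => [|m IH].
  rewrite (_ : (fun _ => _) = fun=> 0)//.
  by apply/funext => x; rewrite big_ord0.
rewrite (_ : (fun _ => _) = fun x => c m * f m x + \sum_(j < m) c j * f j x).
  exact: Scomb.
by apply/funext => x; rewrite big_ord_recr /= addrC.
Qed.

(* The map [x |-> sum_j f_j(x) e_j] is enlarged by the rank one map
   [x |-> g (x - sum_j f_j(x) e_j) u], where [u] is the defect of the new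
   vector and [g u = 1]; it still fixes the previous vectors. *)
Lemma finite_coordinates n (v : nat -> V) : (forall i, E (v i)) ->
  exists m (e : nat -> V) (f : nat -> V -> K),
  [/\ forall j, E (e j), forall j, S (f j) &
      forall i, (i < n)%N -> v i = \sum_(j < m) f j (v i) *: e j].
Proof.
move=> Ev; elim: n => [|n [m [e [f [Ee Sf ef]]]]].
  by exists 0%N, (fun=> 0), (fun=> fun=> 0); split.
pose P x := \sum_(j < m) f j x *: e j.
pose u := v n - P (v n).
have Eu : E u.
  rewrite /u addrC -scaleN1r; apply: Elin => //.
  exact: (comb_sum_closed m (fun j => f j (v n)) Ee).
have [u0|u0] := eqVneq u 0.
  exists m, e, f; split => // i.
  rewrite ltnS leq_eqVlt => /orP[/eqP->|]; last exact: ef.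
  by move/eqP: u0; rewrite subr_eq0 => /eqP.
have [g [Sg gu]] : exists g, S g /\ g u != 0.
  apply: contrapT => H; move/eqP: u0; apply; apply: Ssep => // g Sg.
  by apply/eqP; apply: contrapT => /negP gu; apply: H; exists g.
pose h x := (g u)^-1 * g (x - P x).
have hE : h = fun x => - (g u)^-1 * (\sum_(j < m) g (e j) * f j x)
    + ((g u)^-1 * g x + 0).
  apply/funext => x; rewrite /h addr0.
  have -> : g (x - P x) = g x - \sum_(j < m) g (e j) * f j x.
    rewrite (linB (Slin Sg)) /P (lin_sum (Slin Sg)); congr (_ - _).
    by apply: eq_bigr => j _; exact: mulrC.
  by rewrite mulrBr addrC mulNr.
have Sh : S h.
  rewrite hE; apply: Scomb; last by apply: Scomb.
  exact: (functional_sum_closed m (fun j => g (e j)) Sf).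
exists m.+1, (fun j => if j == m then u else e j).
exists (fun j => if j == m then h else f j).
split => [j|j|i]; [by case: ifP|by case: ifP|].
have sumE x : \sum_(j < m.+1) (if j == m :> nat then h else f j) x *:
    (if j == m :> nat then u else e j) = P x + h x *: u.
  rewrite big_ord_recr /= eqxx; congr (_ + _); apply: eq_bigr => j _.
  by rewrite ltn_eqF.
rewrite sumE ltnS leq_eqVlt => /orP[/eqP->|ni].
  by rewrite /h -/u mulVf// scale1r /u addrC subrK.
have Pv : P (v i) = v i by rewrite /P -ef.
by rewrite /h Pv subrr (lin0 (Slin Sg)) mulr0 scale0r addr0.
Qed.

(** Coordinates that reproduce the generators reproduce their combinations by linearity. Convergence
    in the span then reduces to convergence of finitely many functionals. *)
Lemma finite_coordinates_span n (v : 'I_n -> V) : (forall i, E (v i)) ->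
  exists m (e : nat -> V) (f : nat -> V -> K),
  [/\ forall j, E (e j), forall j, S (f j) &
      forall c : 'I_n -> K, let x := \sum_(i < n) c i *: v i in
      x = \sum_(j < m) f j x *: e j].
Proof.
move=> Ev; pose v' k := if insub k is Some i then v i else 0.
have [k|m [e [f [Ee Sf ef]]]] := @finite_coordinates n v'.
  by rewrite /v'; case: insubP.
exists m, e, f; split => // c x; rewrite {1}/x.
have ev i : v i = \sum_(j < m) f j (v i) *: e j.
  by have := ef i (ltn_ord i); rewrite /v' valK.
under eq_bigr do rewrite ev scaler_sumr.
rewrite exchange_big /=; apply: eq_bigr => j _.
rewrite /x (lin_sum (Slin (Sf j))) scaler_suml.
by apply: eq_bigr => i _; rewrite scalerA.
Qed.

End FiniteCoordinates.

(** * Normed spaces and their duals *)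

Definition cauchy_complete (K : numFieldType) (W : normedModType K) : Prop :=
  forall u : nat -> W, cauchy (u @ \oo) -> cvg (u @ \oo).

Lemma geometric_le (K : numFieldType) (r : nat -> K) (e : K) :
  archimedean_scalars K -> (forall n, 0 <= r n) ->
  (forall n, r n.+1 <= r n / 2) -> 0 < e -> exists n, r n <= e.
Proof.
move=> archK r0 rS e0.
have r2 n : r n * 2 ^+ n <= r 0%N.
  elim: n => [|n]; first by rewrite expr0 mulr1.
  apply: le_trans; rewrite exprS mulrA ler_pM2r ?exprn_gt0//.
  by rewrite -ler_pdivlMr.
have [|N rN] := archK (r 0%N / e); first by rewrite divr_ge0// ltW.
exists N; rewrite -(@ler_pM2r _ (2 ^+ N)) ?exprn_gt0//.
apply: (le_trans (r2 N)); rewrite ler_pdivrMr// mulrC in rN.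
apply: (le_trans rN); rewrite ler_pM2l//.
by rewrite -natrX ler_nat ltnW// ltn_expl.
Qed.

Lemma norm_limit_le (K : numFieldType) (W : normedModType K) (u : nat -> W)
  (l a : W) (c : K) : u @ \oo --> l ->
  (\forall n \near \oo, `|u n - a| <= c) -> `|l - a| <= c.
Proof.
move=> /cvgrPdist_le ul uc; apply/ler_addgt0Pr => e e0.
have [n [ln nc]] : exists n, `|l - u n| <= e /\ `|u n - a| <= c.
  by near \oo => n; exists n; split; near: n; [exact: ul|].
by rewrite -(subrK (u n) l) -addrA addrC (le_trans (ler_normD _ _))// lerD.
Unshelve. all: by end_near. Qed.

Lemma fast_cauchy_limit (K : numFieldType) (W : normedModType K)
    (u : nat -> W) (r : nat -> K) :
  archimedean_scalars K -> cauchy_complete W ->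
  (forall n, 0 <= r n) -> (forall n, r n.+1 <= r n / 2) ->
  (forall n, `|u n.+1 - u n| <= r n / 2) ->
  exists2 l, u @ \oo --> l & forall n, `|l - u n| <= r n.
Proof.
move=> archK cW r0 rS uS.
(* The first step costs [r n / 2], all the remaining ones at most [r n.+1 <= r n / 2]. *)
have ur k n : `|u (n + k)%N - u n| <= r n.
  elim: k n => [|k IH] n; first by rewrite addn0 subrr normr0.
  rewrite -(subrK (u n.+1) (u _)) -addrA addnS -addSn.
  apply: (le_trans (ler_normD _ _)); rewrite [leRHS]splitr.
  by apply: lerD => //; exact: le_trans (IH _) (rS n).
have /cW ul : cauchy (u @ \oo).
  apply: cauchy_exP => e e0; have e20 : 0 < e / 2 by rewrite divr_gt0.
  have [N rN] := geometric_le archK r0 rS e20.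
  exists (u N); exists N => // m /= Nm.
  rewrite -ball_normE /= distrC -(subnKC Nm).
  apply: le_lt_trans (ur _ _) _; apply: le_lt_trans rN _.
  by rewrite ltr_pdivrMr// ltr_pMr// ltr1n.
exists (lim (u @ \oo)) => // n; apply: norm_limit_le ul _.
by exists n => // m /= nm; rewrite -(subnKC nm).
Qed.

Lemma cvg_seq_norm_le (K : numFieldType) (W : normedModType K) (u : nat -> W)
  (l : W) : u @ \oo --> l -> exists2 M, 0 <= M & forall n, `|u n| <= M.
Proof.
move=> ul; have [M [Mr HM]] : bounded_fun u.
  by apply: cvg_seq_bounded; apply/cvg_ex; exists l.
have uM n : `|u n| <= M + 1 by apply: (HM (M + 1)) => //; rewrite ltrDl.
by exists (M + 1) => //; exact: le_trans (uM 0%N).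
Qed.

Lemma cvg_fin_sum (K : numFieldType) (W : normedModType K) m
    (c : nat -> nat -> K) (c' : nat -> K) (e : nat -> W) :
  (forall j, (c j) @ \oo --> c' j) ->
  (fun n => \sum_(j < m) c j n *: e j) @ \oo --> \sum_(j < m) c' j *: e j.
Proof.
move=> cc; apply: cvg_big => [|j _]; first exact: add_continuous.
exact: cvgZr_tmp.
Qed.

(** On the zero space the given constant may be negative or not real; [|C|] always works because
    [C * |x|] is nonnegative. *)
Lemma nonneg_bound (K : numFieldType) (V W : normedModType K) (f : V -> W) :
  (exists C, forall x, `|f x| <= C * `|x|) ->
  exists2 C, 0 <= C & forall x, `|f x| <= C * `|x|.
Proof.
move=> [C fC]; exists `|C| => // x.
have Cx : 0 <= C * `|x| by apply: le_trans (fC x).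
by apply: (le_trans (fC x)); rewrite -{1}(ger0_norm Cx) normrM normr_id.
Qed.

Section Duality.
Variables (K : numFieldType) (X : normedModType K).
Implicit Types (f g : X -> K) (T : X -> X).

Lemma dual_lin f : is_dual f -> lin (f : X -> K^o).
Proof. by case. Qed.

Lemma dual_bound f : is_dual f ->
  exists2 C, 0 <= C & forall x, `|f x| <= C * `|x|.
Proof. by case=> _; exact: (@nonneg_bound K X K^o). Qed.

Lemma dual0 : @is_dual K X (fun=> 0).
Proof.
by split=> [a x y|]; [rewrite mulr0 addr0|exists 0 => x; rewrite normr0 mul0r].
Qed.

Lemma dual_comb a f g : is_dual f -> is_dual g ->
  @is_dual K X (fun x => a * f x + g x).
Proof.
move=> df dg; have [C C0 fC] := dual_bound df; have [D D0 gD] := dual_bound dg.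
split=> [b x y|]; first by rewrite df.1 dg.1; ring.
exists (`|a| * C + D) => x; apply: (le_trans (ler_normD _ _)).
by rewrite mulrDl normrM -mulrA lerD// ler_wpM2l.
Qed.

Lemma dual_comp f T : is_dual f -> bounded_linear T -> is_dual (f \o T).
Proof.
move=> df [Tl [C TC]]; have [D D0 fD] := dual_bound df.
split=> [a x y|] /=; first by rewrite Tl df.1.
by exists (D * C) => x /=; rewrite (le_trans (fD _))// -mulrA ler_wpM2l.
Qed.

Lemma dual_cvg f (u : nat -> X) x : is_dual f -> u @ \oo --> x ->
  (fun n => f (u n)) @ \oo --> f x.
Proof.
move=> df /cvgrPdist_le ux; have [C C0 fC] := dual_bound df.
apply/cvgrPdist_le => e e0.
have d0 : 0 < e / (C + 1) by rewrite divr_gt0// ltr_wpDl.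
have := ux _ d0; apply: filterS => n xn.
have -> : f x - f (u n) = f (x - u n) by rewrite (linB (dual_lin df)).
apply: (le_trans (fC _)); apply: (le_trans (ler_wpM2l C0 xn)).
by rewrite mulrA ler_pdivrMr ?ltr_wpDl// mulrC ler_wpM2l ?lerDl// ltW.
Qed.

Lemma bounded_linear_bound T : bounded_linear T ->
  exists2 C, 0 <= C & forall x, `|T x| <= C * `|x|.
Proof.
by case=> _; exact: nonneg_bound.
Qed.

End Duality.

(** * Norming functionals and separation from subspaces *)

Section HahnBanachCorollaries.
Variables (K : numFieldType) (X : normedModType K).
Hypothesis hbK : hahn_banach K.

Lemma norming_functional (x : X) : exists f : X -> K,
  [/\ is_dual f, forall y, `|f y| <= `|y| & `|x| <= `|f x|].
Proof.
have [|//|//|f [fl fN fx]] :=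
    hbK (V := X) (N := fun v c => `|v| <= c) _ (x0 := x) (e := `|x|).
  split=> [v c|||a v c vc]; first exact: le_trans.
  - by rewrite normr0.
  - by move=> v w c d vc wd; rewrite (le_trans (ler_normD _ _))// lerD.
  - by rewrite normrZ ler_wpM2l.
have fy y : `|f y| <= `|y| by exact: fN.
exists f; split => //; split; first exact: fl.
by exists 1 => y; rewrite mul1r.
Qed.

Lemma dual_separates (x : X) : (forall f, is_dual f -> f x = 0) -> x = 0.
Proof.
move=> fx; have [f [df _]] := norming_functional x.
by rewrite (fx _ df) normr0 normr_le0 => /eqP.
Qed.

Lemma separate_from_subspace (W : set X) (x : X) (e : K) :
  W 0 -> (forall a u v, W u -> W v -> W (a *: u + v)) ->
  0 < e -> (forall w, W w -> e <= `|x - w|) ->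
  exists f, [/\ is_dual f, forall w, W w -> f w = 0 & f x != 0].
Proof.
move=> W0 Wl e0 xW.
(* The gauge is the distance to [W], so domination forces [f] to vanish on [W]. *)
pose N v c := exists2 w, W w & `|v - w| <= c.
have [|c [w Ww xw]|f [fl fN fx]] := hbK (N := N) _ (x0 := x) (ltW e0).
- split.
  + by move=> v c [w _]; exact: le_trans.
  + by exists 0 => //; rewrite subrr normr0.
  + move=> v v' c d [w Ww vw] [w' Ww' vw']; exists (w + w').
      by rewrite -(scale1r w); exact: Wl.
    by rewrite opprD addrACA (le_trans (ler_normD _ _))// lerD.
  + move=> a v c [w Ww vw]; exists (a *: w).
      by rewrite -(addr0 (a *: w)); exact: Wl.
    by rewrite -scalerBr normrZ ler_wpM2l.
- exact: le_trans (xW _ Ww) xw.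
exists f; split.
- split; first exact: fl.
  by exists 1 => y; rewrite mul1r; apply: fN; exists 0 => //; rewrite subr0.
- move=> w Ww; apply/eqP; rewrite -normr_le0; apply: fN; exists w => //.
  by rewrite subrr normr0.
- by rewrite -normr_gt0; exact: lt_le_trans fx.
Qed.

(** The gauge is the dual-norm distance to [W] on all functions [X -> K], infinite where no bound
    exists, so the dual need not be built as a normed space. *)
Lemma bidual_separate (W : set (X -> K)) (phi : X -> K) (e : K) :
  W (fun=> 0) -> (forall a f g, W f -> W g -> W (fun x => a * f x + g x)) ->
  0 < e -> (forall w, W w -> ~ dual_dist_le phi w e) ->
  exists F : (X -> K) -> K,
    [/\ forall a f g, F (fun x => a * f x + g x) = a * F f + F g,
        forall f c, 0 <= c -> (forall x, `|f x| <= c * `|x|) -> `|F f| <= c,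
        forall w, W w -> F w = 0 & F phi != 0].
Proof.
move=> W0 Wl e0 xW.
(* [0 <= c] is explicit because on the zero space [dual_dist_le] also holds for negative
   constants. *)
pose N (v : X -> K^o) (c : K) := 0 <= c /\ exists2 w, W w & dual_dist_le v w c.
have [|c [c0 [w Ww xw]]|F [Fl FN Fphi]] := hbK (N := N) _ (x0 := phi) (ltW e0).
- split.
  + by move=> v c [].
  + by split=> //; exists (fun=> 0) => // x; rewrite subrr normr0 mul0r.
  + move=> v v' c d [c0 [w Ww vw]] [d0 [w' Ww' vw']].
    split; first exact: addr_ge0.
    exists (fun x => 1 * w x + w' x); first exact: Wl.
    move=> x; rewrite mul1r mulrDl opprD addrACA.
    by rewrite (le_trans (ler_normD _ _))// lerD.
  + move=> a v c [c0 [w Ww vw]]; split; first exact: mulr_ge0.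
    exists (fun x => a * w x + 0); first exact: Wl.
    by move=> x; rewrite addr0 -mulrBr normrM -mulrA ler_wpM2l.
- rewrite (real_leNgt (gtr0_real e0) (ger0_real c0)); apply/negP => ce.
  apply: (xW _ Ww) => x; apply: le_trans (xw x) _.
  by rewrite ler_wpM2r// ltW.
exists F; split.
- by move=> a f g; exact: Fl.
- move=> f c c0 fc; apply: FN; split => //; exists (fun=> 0) => // x.
  by rewrite subr0.
- move=> w Ww; apply/eqP; rewrite -normr_le0; apply: FN; split => //.
  by exists w => // x; rewrite subrr normr0 mul0r.
- by rewrite -normr_gt0; exact: lt_le_trans Fphi.
Qed.

End HahnBanachCorollaries.

Lemma cvg_seq_unique (K : numFieldType) (W : normedModType K) (u : nat -> W)
  (l l' : W) : u @ \oo --> l -> u @ \oo --> l' -> l = l'.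
Proof. by move=> ul ul'; apply: cvg_unique ul ul'; exact: norm_hausdorff. Qed.

(** * Uniform boundedness on a Banach space and on closed subspaces of its dual *)

Section BanachSteinhaus.
Variables (K : numFieldType) (X : normedModType K).
Hypothesis archK : archimedean_scalars K.

Lemma uniform_boundedness_space (I : Type) (q : I -> X -> K) :
  cauchy_complete X ->
  (forall i v, 0 <= q i v) -> (forall i v w, q i (v + w) <= q i v + q i w) ->
  (forall i a v, q i (a *: v) = `|a| * q i v) ->
  (forall i, exists2 C, 0 <= C & forall v, q i v <= C * `|v|) ->
  (forall v, exists M, forall i, q i v <= M) ->
  exists2 M, 0 <= M & forall i v, q i v <= M * `|v|.
Proof.
move=> cX q0 qD qZ qB qp.
have [M M0 qM] : exists2 M, 0 <= M & forall i v c, [set: X] v -> 0 < c ->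
    `|v| <= c -> q i v <= M * c.
  apply: uniform_boundedness => //.
  - by move=> a v c vc; rewrite normrZ ler_wpM2l.
  - move=> x r _ r0 rS xS.
    have [l _ lx] := fast_cauchy_limit archK cX (fun n => ltW (r0 n)) rS xS.
    by exists l.
  - move=> i; have [C C0 qC] := qB i; exists C => // v c _ vc.
    by apply: le_trans (qC v) _; rewrite ler_wpM2l.
exists M => // i v; have [->|v0] := eqVneq v 0.
  by rewrite -(scale0r (0 : X)) qZ normr0 mul0r scale0r normr0 mulr0.
by apply: qM => //; rewrite normr_gt0.
Qed.

Hypothesis cK : cauchy_complete K^o.

(** Completeness of the dual in the form the nested balls require: limits are taken pointwise in
    [K], and linearity and the bounds pass to the limit. *)
Lemma dual_fast_limit (phi : nat -> X -> K) (r : nat -> K) :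
  (forall n, is_dual (phi n)) -> (forall n, 0 < r n) ->
  (forall n, r n.+1 <= r n / 2) ->
  (forall n, dual_dist_le (phi n.+1) (phi n) (r n / 2)) ->
  exists2 l, is_dual l & forall n, dual_dist_le l (phi n) (r n).
Proof.
move=> dphi r0 rS phiS.
have lim_at x : exists l : K^o, (fun n => phi n x : K^o) @ \oo --> l /\
    forall n, `|l - phi n x| <= r n * `|x|.
  have [n|n|n|l lx lr] := @fast_cauchy_limit K K^o (fun n => phi n x)
      (fun n => r n * `|x|) archK cK.
  - by rewrite mulr_ge0// ltW.
  - by rewrite mulrAC ler_wpM2r.
  - by rewrite mulrAC; exact: phiS.
  by exists l.
have [l lP] := choice lim_at.
have ll x := (lP x).1; have lr x n := (lP x).2 n.
exists l => [|n x]; last exact: lr.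
split=> [a x y|].
  apply: (@cvg_seq_unique K K^o (fun n => phi n (a *: x + y))); first exact: ll.
  under eq_fun do rewrite (dphi _).1.
  by apply: cvgD; [apply: cvgMl_tmp|]; exact: ll.
have [C C0 phiC] := dual_bound (dphi 0%N).
exists (r 0%N + C) => x; rewrite -(subrK (phi 0%N x) (l x)).
by rewrite (le_trans (ler_normD _ _))// mulrDl lerD.
Qed.

Lemma uniform_boundedness_dual (W : set (X -> K)) (I : Type) (p : I -> X) :
  W `<=` @is_dual K X -> W (fun=> 0) ->
  (forall a f g, W f -> W g -> W (fun x => a * f x + g x)) ->
  dual_closure W `<=` W ->
  (forall f, W f -> exists M, forall i, `|f (p i)| <= M) ->
  exists2 M, 0 <= M & forall i f c, W f -> 0 < c ->
    (forall x, `|f x| <= c * `|x|) -> `|f (p i)| <= M * c.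
Proof.
move=> Wd W0 Wl Wcl Wp.
apply: (@uniform_boundedness K (X -> K^o) W
  (fun f c => forall x, `|f x| <= c * `|x|) archK W0 Wl) => //.
- by move=> a f c fc x; rewrite normrM -mulrA ler_wpM2l.
- move=> x r Wx r0 rS xS.
  have [l dl lr] := dual_fast_limit (fun n => Wd _ (Wx n)) r0 rS xS.
  exists l; last exact: lr.
  apply: Wcl; split => // e e0.
  have [n rn] := geometric_le archK (fun n => ltW (r0 n)) rS e0.
  exists (x n); split => // y; apply: le_trans (lr n y) _.
  by rewrite ler_wpM2r.
- by move=> i f g; exact: ler_normD.
- by move=> i a f; exact: normrM.
- by move=> i; exists `|p i| => // f c _ fc; rewrite mulrC; exact: fc.
Qed.

(** Uniform boundedness on the dual, applied to evaluations at the [p i]; a norming functional then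
    recovers [|p i|]. *)
Lemma weakly_bounded_norm_bounded (I : Type) (p : I -> X) : hahn_banach K ->
  (forall f, is_dual f -> exists M, forall i, `|f (p i)| <= M) ->
  exists2 M, 0 <= M & forall i, `|p i| <= M.
Proof.
move=> hbK pb.
have [//| | |f []//|//|M M0 pM] := @uniform_boundedness_dual (@is_dual K X) I p.
- exact: dual0.
- exact: dual_comb.
exists M => // i; have [f [df f1 fp]] := norming_functional hbK (p i).
apply: le_trans fp _; rewrite -[M]mulr1; apply: pM => // x.
by rewrite mul1r.
Qed.

End BanachSteinhaus.

(** * Linear spans and dual-norm closures *)

Section Spans.
Variables (K : numFieldType) (X : normedModType K).

Lemma spanX_comb (A : set X) a u v :
  spanX A u -> spanX A v -> spanX A (a *: u + v).
Proof.
move=> [n [w [c [Aw ->]]]] [m [w' [c' [Aw' ->]]]].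
exists (n + m)%N.
exists (fun i => match fintype.split i with inl j => w j | inr j => w' j end).
exists (fun i =>
  match fintype.split i with inl j => a * c j | inr j => c' j end).
split; first by move=> i; case: (fintype.split i).
rewrite big_split_ord /= scaler_sumr; congr (_ + _); apply: eq_bigr => i _.
  by rewrite (unsplitK (inl i)) scalerA.
by rewrite (unsplitK (inr i)).
Qed.

Lemma spanX0 (A : set X) : spanX A 0.
Proof.
exists 0%N, (fun=> 0), (fun=> 0); split; first by case.
by rewrite big_ord0.
Qed.

Lemma sub_spanX (A : set X) : A `<=` spanX A.
Proof.
move=> x Ax; exists 1%N, (fun=> x), (fun=> 1); split => //.
by rewrite big_ord1 scale1r.
Qed.

Lemma spanD_comb (A : set (X -> K)) a f g :
  spanD A f -> spanD A g -> spanD A (fun x => a * f x + g x).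
Proof.
move=> [n [w [c [Aw ->]]]] [m [w' [c' [Aw' ->]]]].
exists (n + m)%N.
exists (fun i => match fintype.split i with inl j => w j | inr j => w' j end).
exists (fun i =>
  match fintype.split i with inl j => a * c j | inr j => c' j end).
split; first by move=> i; case: (fintype.split i).
apply/funext => x.
rewrite big_split_ord /= mulr_sumr; congr (_ + _); apply: eq_bigr => i _.
  by rewrite (unsplitK (inl i)) mulrA.
by rewrite (unsplitK (inr i)).
Qed.

Lemma spanD0 (A : set (X -> K)) : spanD A (fun=> 0).
Proof.
exists 0%N, (fun=> fun=> 0), (fun=> 0); split; first by case.
by apply/funext => x; rewrite big_ord0.
Qed.

Lemma sub_spanD (A : set (X -> K)) : A `<=` spanD A.
Proof.
move=> f Af; exists 1%N, (fun=> f), (fun=> 1); split => //.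
by apply/funext => x; rewrite big_ord1 mul1r.
Qed.

Lemma spanD_dual (A : set (X -> K)) :
  A `<=` @is_dual K X -> spanD A `<=` @is_dual K X.
Proof.
move=> Ad _ [n [g [c [Ag ->]]]].
elim: n g c Ag => [|n IH] g c Ag.
  rewrite (_ : (fun _ => _) = fun=> 0); first exact: dual0.
  by apply/funext => x; rewrite big_ord0.
rewrite (_ : (fun _ => _) = fun x => c ord0 * g ord0 x +
    \sum_(i < n) c (lift ord0 i) * g (lift ord0 i) x).
  apply: dual_comb; first by apply: Ad; exact: Ag.
  exact: (IH (fun i => g (lift ord0 i)) (fun i => c (lift ord0 i))
    (fun i => Ag _)).
by apply/funext => x; rewrite big_ord_recl.
Qed.

Lemma dual_dist_trans (f g h : X -> K) (d e : K) :
  dual_dist_le f g d -> dual_dist_le g h e -> dual_dist_le f h (d + e).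
Proof.
move=> fg gh x; rewrite -(subrK (g x) (f x)) -addrA mulrDl.
by rewrite (le_trans (ler_normD _ _))// lerD.
Qed.

Lemma sub_dual_closure (A : set (X -> K)) :
  A `<=` @is_dual K X -> A `<=` dual_closure A.
Proof.
move=> Ad f Af; split; first exact: Ad.
move=> e e0; exists f; split => // x; rewrite subrr normr0.
by rewrite mulr_ge0// ltW.
Qed.

Lemma dual_closureK (A : set (X -> K)) :
  dual_closure (dual_closure A) `<=` dual_closure A.
Proof.
move=> f [df fA]; split => // e e0; have e20 : 0 < e / 2 by rewrite divr_gt0.
have [g [[dg gA] fg]] := fA _ e20; have [h [Ah gh]] := gA _ e20.
by exists h; split => //; rewrite (splitr e); exact: dual_dist_trans fg gh.
Qed.

Lemma dual_closure_comb (A : set (X -> K)) a f g :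
  (forall a f g, A f -> A g -> A (fun x => a * f x + g x)) ->
  dual_closure A f -> dual_closure A g ->
  dual_closure A (fun x => a * f x + g x).
Proof.
move=> Al [df fA] [dg gA]; split; first exact: dual_comb.
move=> e e0; have e20 : 0 < e / 2 by rewrite divr_gt0.
have a1 : 0 < `|a| + 1 by rewrite ltr_wpDl.
have d0 : 0 < e / 2 / (`|a| + 1) by rewrite divr_gt0.
have [f' [Af ff]] := fA _ d0; have [g' [Ag gg]] := gA _ e20.
exists (fun x => a * f' x + g' x); split; first exact: Al.
move=> x; rewrite opprD addrACA -mulrBr (splitr e) mulrDl.
apply: (le_trans (ler_normD _ _)); apply: lerD; last exact: gg.
rewrite normrM; apply: (le_trans (ler_wpM2l (normr_ge0 a) (ff x))).
rewrite mulrA ler_wpM2r// mulrA ler_pdivrMr// mulrC.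
by rewrite ler_wpM2l ?lerDl// ltW.
Qed.

End Spans.

(** * Sequences of finite-rank operators *)

Section OperatorSequence.
Variables (K : numFieldType) (X : normedModType K).
Hypotheses (archK : archimedean_scalars K) (cK : cauchy_complete K^o).
Hypotheses (hbK : hahn_banach K) (cX : cauchy_complete X).
Variable T : nat -> X -> X.
Hypothesis Tb : forall n, bounded_linear (T n).
Hypothesis Tf : forall n, finite_rank (T n).
Hypothesis Tinv : forall m n x, exists y, T n (T m x) = T m y.
Hypothesis Tadj : forall m n phi, is_dual phi ->
  exists psi, is_dual psi /\ adj (T n) (adj (T m) phi) = adj (T m) psi.

Let Tlin n : lin (T n) := (Tb n).1.

(** Uniform boundedness is used twice: on the dual for each fixed [x], then on [X]. *)
Lemma pointwise_weakly_bounded_uniform :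
  (forall f x, is_dual f -> exists M, forall n, `|f (T n x)| <= M) ->
  exists2 M, 0 <= M & forall n x, `|T n x| <= M * `|x|.
Proof.
move=> Tw; apply: (@uniform_boundedness_space K X archK nat
  (fun n x => `|T n x|)) => //.
- by move=> n x y; rewrite (linD (Tlin n)) ler_normD.
- by move=> n a x; rewrite (linZ (Tlin n)) normrZ.
- by move=> n; exact: bounded_linear_bound.
move=> x; have [f /Tw|M _ TM] :=
  weakly_bounded_norm_bounded archK cK (p := fun n => T n x) hbK; first exact.
by exists M.
Qed.

Lemma range_coordinates (S : set (X -> K)) m :
  S (fun=> 0) -> (forall a f g, S f -> S g -> S (fun x => a * f x + g x)) ->
  S `<=` @is_dual K X -> (forall x, (forall f, S f -> f x = 0) -> x = 0) ->
  exists k (e : nat -> X) (f : nat -> X -> K), (forall j, S (f j)) /\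
    forall x, T m x = \sum_(j < k) f j (T m x) *: e j.
Proof.
move=> S0 Sl Sd Ssep; have [n [v Tv]] := Tf m.
have [k [e [f [_ Sf fE]]]] := finite_coordinates_span (E := setT) I
  (fun _ _ _ _ _ => I) S0 Sl (fun f Sf => dual_lin (Sd f Sf))
  (fun x _ => Ssep x) (fun i => I : setT (v i)).
exists k, e, f; split => // x; have [c ->] := Tv x; exact: fE.
Qed.

(** By invariance one coordinate system on the range of [T m] describes all [T n (T m x)], so
    convergence along [S] is enough. [S] is the dual when starting from (i), [Zspace T] when
    starting from (iv). *)
Lemma cvg_on_ranges (S : set (X -> K)) :
  S (fun=> 0) -> (forall a f g, S f -> S g -> S (fun x => a * f x + g x)) ->
  S `<=` @is_dual K X -> (forall x, (forall f, S f -> f x = 0) -> x = 0) ->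
  (forall f x, S f -> (fun n => f (T n x)) @ \oo --> f x) ->
  forall m x, (fun n => T n (T m x)) @ \oo --> T m x.
Proof.
move=> S0 Sl Sd Ssep Sc m x.
have [k [e [f [Sf fE]]]] := range_coordinates m S0 Sl Sd Ssep.
rewrite [X in _ --> X]fE.
have -> : (fun n => T n (T m x)) =
    fun n => \sum_(j < k) f j (T n (T m x)) *: e j.
  by apply/funext => n; have [y ->] := Tinv m n x; exact: fE.
exact: (cvg_fin_sum (c := fun j n => f j (T n (T m x)))
  (fun j => Sc _ (T m x) (Sf j))).
Qed.

Lemma cvg_everywhere M : 0 <= M -> (forall n x, `|T n x| <= M * `|x|) ->
  (forall m x, (fun n => T n (T m x)) @ \oo --> T m x) ->
  Yspace T = setT -> forall x, (fun n => T n x) @ \oo --> x.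
Proof.
move=> M0 TM Tr Yt x.
have Tspan w : spanX [set y | exists m, range (T m) y] w ->
    (fun n => T n w) @ \oo --> w.
  move=> [k [v [c [vT ->]]]].
  under eq_fun do rewrite (lin_sum (Tlin _)).
  apply: cvg_big => [|i _]; first exact: add_continuous.
  have [m [y _ <-]] := vT i.
  by apply: cvgZl_tmp; exact: Tr.
apply/cvgrPdist_le => e e0; have e20 : 0 < e / 2 by rewrite divr_gt0.
(* The approximation error counts once directly and once through [T n], magnified by at most [M]. *)
have d0 : 0 < e / 2 / (1 + M) by rewrite divr_gt0// ltr_pwDl.
have : Yspace T x by rewrite Yt.
move=> /(_ (ball x (e / 2 / (1 + M)))) [|w [Ww]]; first exact: nbhsx_ballx.
rewrite -ball_normE /= => /ltW xw.
have /cvgrPdist_le /(_ _ e20) := Tspan _ Ww; apply: filterS => n wn.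
apply: (le_trans (ler_distD w _ _)); rewrite [leRHS]splitr.
apply: (@le_trans _ _ (e / 2 / (1 + M) + (e / 2 + M * (e / 2 / (1 + M))))).
  apply: lerD => //; apply: (le_trans (ler_distD (T n w) _ _)).
  apply: lerD => //; rewrite -(linB (Tlin n)); apply: (le_trans (TM n _)).
  by rewrite ler_wpM2l// distrC.
rewrite addrCA lerD2l -{1}[e / 2 / _]mul1r -mulrDl mulrCA divff ?mulr1//.
by rewrite gt_eqF// ltr_pwDl.
Qed.

(** A functional vanishing on all ranges vanishes at every [T n x], hence at the weak limit [x], so
    it cannot separate [x] from [Yspace T]. *)
Lemma weak_cvg_Yspace : (forall x, weak_cvg (fun n => T n x) x) ->
  Yspace T = setT.
Proof.
move=> Tw; apply/seteqP; split => // x _.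
set A := [set y | exists m, range (T m) y].
apply: contrapT => nYx.
have [e e0 xe] : exists2 e : K, 0 < e & forall w, spanX A w -> e <= `|x - w|.
  apply: contrapT => H; apply: nYx => B /nbhs_ballP [e /= e0 eB].
  apply: contrapT => AB; apply: H; exists e => // w Aw.
  rewrite (real_leNgt (gtr0_real e0) (normr_real _)); apply/negP => we.
  by apply: AB; exists w; split => //; apply: eB; rewrite -ball_normE.
have [f [df f0 /eqP]] := separate_from_subspace hbK (spanX0 A)
  (fun a u v => @spanX_comb K X A a u v) e0 xe; apply.
apply: (@cvg_seq_unique K K^o (fun n => f (T n x))); first exact: Tw.
rewrite (_ : (fun n => _) = fun=> 0); first exact: cvg_cst.
by apply/funext => n; apply: f0; apply: sub_spanX; exists n, x.
Qed.

Let G := [set psi | exists m phi, is_dual phi /\ psi = adj (T m) phi].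

Let G_dual : G `<=` @is_dual K X.
Proof. by move=> _ [m [phi [dphi ->]]]; exact: dual_comp. Qed.

Lemma Zspace_dual : Zspace T `<=` @is_dual K X.
Proof. by move=> f []. Qed.

Lemma Zspace_comb a f g : Zspace T f -> Zspace T g ->
  Zspace T (fun x => a * f x + g x).
Proof.
by move=> Zf Zg; apply: dual_closure_comb => // b h k; exact: spanD_comb.
Qed.

Lemma Zspace0 : Zspace T (fun=> 0).
Proof. by apply: sub_dual_closure (spanD0 _); exact: spanD_dual. Qed.

Lemma Zspace_adj m phi : is_dual phi -> Zspace T (adj (T m) phi).
Proof.
move=> dphi; apply: sub_dual_closure; first exact: spanD_dual.
by apply: sub_spanD; exists m, phi.
Qed.

(* [T_n^* T_m^* phi] stays in the finite-dimensional space [T_m^* X^*], where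
   pointwise convergence is norm convergence. *)
Lemma adj_cvg_on_ranges m phi :
  (forall f, is_dual f -> weakstar_cvg (fun n => adj (T n) f) f) ->
  is_dual phi ->
  dual_norm_cvg (fun n => adj (T n) (adj (T m) phi)) (adj (T m) phi).
Proof.
move=> Tw dphi.
have [k [e [f [df fE]]]] := range_coordinates m (@dual0 K X)
  (@dual_comb K X) (fun _ h => h) (dual_separates hbK).
set psi := adj (T m) phi.
have dpsi : is_dual psi by exact: dual_comp.
pose u n : X -> K^o := adj (T n) psi.
(* With this choice the coordinates converge along [u] by construction; evaluations at points belong
   to [S] by weak* convergence, so [S] separates. *)
pose S : set ((X -> K^o) -> K) := [set F | lin (F : (X -> K^o) -> K^o) /\
  (fun n => F (u n)) @ \oo --> F psi].
have [||||k' [g [F [dg SF FE]]]] := finite_coordinates_span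
  (V := X -> K^o) (E := @is_dual K X) (S := S) (@dual0 K X) (@dual_comb K X)
  _ _ _ _ (fun i : 'I_k => dual_comp (df i) (Tb m)).
- split; last exact: cvg_cst.
  by move=> a x y; rewrite scaler0 addr0.
- move=> a F1 F2 [l1 c1] [l2 c2]; split.
    by move=> b x y; rewrite l1 l2 scalerDr /GRing.scale /=; ring.
  by apply: cvgD => //; exact: cvgMl_tmp.
- by move=> F [].
- move=> h dh hS; apply/funext => x; apply: (hS (fun h' => h' x)); split => //.
  exact: Tw.
(* Applying [h] to the expansion of [T m x] places [adj (T m) h] in the span of the [f i \o T m]. *)
have adjE h : is_dual h -> adj (T m) h = \sum_(j < k') F j (adj (T m) h) *: g j.
  move=> dh.
  have -> : adj (T m) h = \sum_(i < k) h (e i) *: (f i \o T m : X -> K^o).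
    apply/funext => x; rewrite fct_sumE /adj /= {1}fE (lin_sum (dual_lin dh)).
    by apply: eq_bigr => i _; exact: mulrC.
  exact: FE.
have uE n : u n = \sum_(j < k') F j (u n) *: g j.
  by rewrite /u; have [h [dh ->]] := Tadj m n dphi; exact: adjE.
have gC j : exists C, 0 <= C /\ forall x, `|g j x| <= C * `|x|.
  by have [C C0 gC] := dual_bound (dg j); exists C.
have [C CP] := choice gC.
pose s n := \sum_(j < k') `|F j (u n) - F j psi| * C j.
have s0 n : 0 <= s n.
  by apply: sumr_ge0 => j _; rewrite mulr_ge0//; exact: (CP j).1.
have /cvgrPdist_le sc : (fun n => s n : K^o) @ \oo --> (0 : K^o).
  rewrite (_ : 0 = \sum_(j < k') (0 : K) *: (C j : K^o)); last first.
    by rewrite big1// => j _; rewrite scale0r.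
  apply: (cvg_fin_sum (c := fun j n => `|F j (u n) - F j psi|)
    (c' := fun=> 0)) => j.
  rewrite -(normr0 K) -(subrr (F j psi)); apply: cvg_norm.
  by apply: cvgB; [exact: (SF j).2|exact: cvg_cst].
move=> d d0; have := sc _ d0; apply: filterS => n; rewrite sub0r normrN.
rewrite ger0_norm// => sd x.
apply: (@le_trans _ _ (s n * `|x|)); last by rewrite ler_wpM2r.
have -> : adj (T n) psi x - psi x =
    \sum_(j < k') (F j (u n) - F j psi) * g j x.
  have ux : u n x = \sum_(j < k') F j (u n) * g j x by rewrite {1}uE fct_sumE.
  have psix : psi x = \sum_(j < k') F j psi * g j x.
    by rewrite {1}/psi (adjE _ dphi) fct_sumE.
  rewrite -/(u n x) ux psix -sumrB.
  by apply: eq_bigr => j _; rewrite mulrBl.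
apply: (le_trans (ler_norm_sum _ _ _)); rewrite /s mulr_suml.
apply: ler_sum => j _; rewrite normrM -mulrA ler_wpM2l//.
exact: (CP j).2.
Qed.

(** Convergence on the adjoint ranges passes to finite sums, then to the dual-norm closure because
    [M] bounds all adjoints at once. *)
Lemma adj_norm_cvg M : 0 <= M -> (forall n x, `|T n x| <= M * `|x|) ->
  (forall f, is_dual f -> weakstar_cvg (fun n => adj (T n) f) f) ->
  forall phi, Zspace T phi -> dual_norm_cvg (fun n => adj (T n) phi) phi.
Proof.
move=> M0 TM Tw.
have span_cvg psi : spanD G psi -> dual_norm_cvg (fun n => adj (T n) psi) psi.
  move=> [k [g [c [Gg ->]]]] e e0.
  pose c1 := \sum_(i < k) `|c i|.
  have c10 : 0 < c1 + 1 by rewrite ltr_wpDl// sumr_ge0.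
  have d0 : 0 < e / (c1 + 1) by rewrite divr_gt0.
  have : \forall n \near \oo,
      forall i, dual_dist_le (adj (T n) (g i)) (g i) (e / (c1 + 1)).
    apply: filter_forall => i; have [m [phi [dphi ->]]] := Gg i.
    exact: adj_cvg_on_ranges.
  apply: filterS => n gn x; rewrite /adj /= -sumrB.
  under eq_bigr do rewrite -mulrBr.
  apply: (le_trans (ler_norm_sum _ _ _)).
  apply: (@le_trans _ _ (\sum_(i < k) `|c i| * (e / (c1 + 1) * `|x|))).
    by apply: ler_sum => i _; rewrite normrM ler_wpM2l//; exact: gn.
  rewrite -mulr_suml mulrA ler_wpM2r// mulrA ler_pdivrMr// mulrC.
  by rewrite ler_wpM2l ?lerDl// ltW.
move=> phi [dphi phiG] e e0.
have e20 : 0 < e / 2 by rewrite divr_gt0.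
have d0 : 0 < e / 2 / (M + 1) by rewrite divr_gt0// ltr_wpDl.
have [psi [Gpsi pd]] := phiG _ d0.
have := span_cvg _ Gpsi _ e20; apply: filterS => n pn x.
apply: (le_trans (ler_distD (psi (T n x)) _ _)).
rewrite [e]splitr mulrDl addrC.
apply: (@le_trans _ _ (e / 2 * `|x| + e / 2 / (M + 1) * `|x|
    + e / 2 / (M + 1) * (M * `|x|))).
  apply: lerD.
    apply: (le_trans (ler_distD (psi x) _ _)); apply: lerD; first exact: pn.
    by rewrite distrC; exact: pd.
  by apply: (le_trans (pd _)); rewrite ler_wpM2l// ltW.
rewrite -addrA lerD2l mulrA -mulrDl ler_wpM2r//.
rewrite -{1}[e / 2 / _]mulr1 -mulrDr [1 + M]addrC mulfVK//.
by rewrite gt_eqF// ltr_wpDl.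
Qed.

Lemma Zspace_weakstar_seq_dense :
  (forall f, is_dual f -> weakstar_cvg (fun n => adj (T n) f) f) ->
  weakstar_seq_dense (Zspace T).
Proof.
move=> Tw phi dphi; exists (fun n => adj (T n) phi); split; last exact: Tw.
by move=> n; exact: Zspace_adj.
Qed.

Lemma Zspace_separates : weakstar_seq_dense (Zspace T) ->
  forall x : X, (forall f, Zspace T f -> f x = 0) -> x = 0.
Proof.
move=> Zd x Zx; apply: dual_separates => // f df.
have [u [Zu uf]] := Zd _ df.
apply: (@cvg_seq_unique K K^o (fun n => u n x)); first exact: uf.
by under eq_fun do rewrite Zx//; exact: cvg_cst.
Qed.

(** On [Zspace T] the bound depends only on the norm of the functional, and norms along a
    weak*-convergent sequence are bounded, so the bound passes to the limit [f]. *)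
Lemma Zspace_weakly_bounded :
  (forall phi, Zspace T phi -> weakstar_cvg (fun n => adj (T n) phi) phi) ->
  weakstar_seq_dense (Zspace T) ->
  forall f x, is_dual f -> exists M, forall n, `|f (T n x)| <= M.
Proof.
move=> Zc Zd f x df.
have [f0 Zf0|M M0 TM] := uniform_boundedness_dual archK cK (p := fun n => T n x)
    Zspace_dual Zspace0 Zspace_comb (@dual_closureK _ _ _).
  by have [C _ uC] := cvg_seq_norm_le (W := K^o) (Zc _ Zf0 x); exists C.
have [u [Zu uf]] := Zd _ df.
have du k : is_dual (u k) by exact: Zspace_dual.
have [C C0 uC] : exists2 C, 0 <= C & forall k y, `|u k y| <= C * `|y|.
  apply: (@uniform_boundedness_space K X archK nat (fun k y => `|u k y|)) => //.
  - by move=> k y z; rewrite (linD (dual_lin (du k))) ler_normD.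
  - by move=> k a y; rewrite (linZ (dual_lin (du k))) normrM.
  - by move=> k; exact: dual_bound.
  - by move=> y; have [C _ uC] := cvg_seq_norm_le (W := K^o) (uf y); exists C.
have C1 : 0 < C + 1 by rewrite ltr_wpDl.
exists (M * (C + 1)) => n; rewrite -(subr0 (f _)).
apply: (@norm_limit_le K K^o (fun k => u k (T n x))); first exact: uf.
near=> k; rewrite subr0; apply: TM => // y.
by apply: le_trans (uC _ _) _; rewrite ler_wpM2r// lerDl.
Unshelve. all: by end_near. Qed.

(** Otherwise a bidual functional [F] vanishes on the adjoint ranges but not at [phi]. By
    reflexivity it is evaluation at some [x]; all of [Zspace T] vanishes there, so [x = 0] and
    [F phi = 0]. *)
Lemma reflexive_Zspace : @Defs.reflexive K X -> weakstar_seq_dense (Zspace T) ->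
  forall phi, is_dual phi -> Zspace T phi.
Proof.
move=> refl Zd phi dphi; split => // e e0; apply: contrapT => H.
have [F [Fl Fb F0 /eqP]] := bidual_separate (phi := phi) hbK (spanD0 G)
  (fun a f g => @spanD_comb K X G a f g) e0
  (fun w Gw we => H (ex_intro _ w (conj Gw we))); apply.
have [||x Fx] := refl F.
- by move=> a f g _ _; exact: Fl.
(* A nonzero point forces [0 <= c]. On the zero space [c] may be negative, but [F] vanishes on the
   dual and the constant 0 works. *)
- have [[x0 x00]|X0] := pselect (exists x0 : X, x0 != 0).
    exists 1 => f c _ fc; rewrite mul1r; apply: Fb => //.
    have := le_trans (normr_ge0 _) (fc x0).
    by rewrite pmulr_lge0// normr_gt0.
  exists 0 => f c df _; rewrite mul0r; apply: Fb => // x.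
  have [->|x0] := eqVneq x 0; last by case: X0; exists x.
  have f0 : f 0 = 0 := lin0 (dual_lin df).
  by rewrite f0 !normr0 mul0r.
rewrite Fx//; suff -> : x = 0 by exact: lin0 (dual_lin dphi).
apply: Zspace_separates => // f [df fG]; apply/eqP; rewrite -normr_le0.
apply/ler_addgt0Pr => d d0; rewrite add0r.
have d1 : 0 < d / (`|x| + 1) by rewrite divr_gt0// ltr_wpDl.
have [w [Gw fw]] := fG _ d1.
have := fw x; rewrite -(Fx w); last exact: spanD_dual Gw.
rewrite F0// subr0 => /le_trans; apply.
rewrite mulrAC ler_pdivrMr ?ltr_wpDl// ler_wpM2l ?lerDl//; exact: ltW.
Qed.

End OperatorSequence.

(** (i) and (iii) differ only in the order of quantifiers. The rest is the cycle (i), (v), (iv),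
    (ii), (i), with (i) to (ii) also direct; under reflexivity [Zspace T] is the whole dual, so (v)
    gives (vi), and (vi) gives (iii). *)
Lemma theorem2p1_generic (K : numFieldType) (X : normedModType K) :
  archimedean_scalars K -> cauchy_complete K^o -> hahn_banach K ->
  cauchy_complete X -> @theorem2p1_statement K X.
Proof.
move=> archK cK hbK cX T Tb Tf Tinv Tadj c1 c2 c3 c4 c5 c6.
have i1_3 : c1 -> c3 by move=> h f df x; exact: h.
have i3_1 : c3 -> c1 by move=> h x f df; exact: h.
have i2_1 : c2 -> c1 by move=> h x f df; exact: dual_cvg.
have i1_b : c1 -> exists2 M, 0 <= M & forall n x, `|T n x| <= M * `|x|.
  move=> h; apply: pointwise_weakly_bounded_uniform => // f x df.
  by have [M _ fM] := cvg_seq_norm_le (W := K^o) (h x f df); exists M.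
have i1_2 : c1 -> c2.
  move=> h; have [M M0 TM] := i1_b h.
  apply: (cvg_everywhere Tb M0 TM) (weak_cvg_Yspace hbK h).
  apply: (cvg_on_ranges Tf Tinv (@dual0 K X) (@dual_comb K X)) => //.
    exact: dual_separates.
  by move=> f x df; exact: h.
have i1_5 : c1 -> c5.
  move=> h; have [M M0 TM] := i1_b h; split; last split.
  - exact: (adj_norm_cvg hbK Tb Tf Tadj M0 TM (i1_3 h)).
  - exact: Zspace_weakstar_seq_dense (i1_3 h).
  - exact: weak_cvg_Yspace.
have norm_weakstar u phi : dual_norm_cvg u phi -> @weakstar_cvg K X u phi.
  move=> up x; apply/cvgrPdist_le => e e0.
  have d0 : 0 < e / (`|x| + 1) by rewrite divr_gt0// ltr_wpDl.
  have := up _ d0; apply: filterS => n /(_ x).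
  rewrite distrC => /le_trans; apply.
  by rewrite mulrAC ler_pdivrMr ?ltr_wpDl// ler_wpM2l ?lerDl//; exact: ltW.
have i5_4 : c5 -> c4.
  by move=> [h hs]; split => // phi Zphi; apply: norm_weakstar; exact: h.
have i4_1 : c4 -> c1.
  move=> [Zc [Zd Yt]]; apply: i2_1.
  have [M M0 TM] : exists2 M, 0 <= M & forall n x, `|T n x| <= M * `|x|.
    apply: pointwise_weakly_bounded_uniform => //.
    exact: Zspace_weakly_bounded.
  apply: (cvg_everywhere Tb M0 TM) Yt.
  apply: (cvg_on_ranges Tf Tinv (Zspace0 Tb) (Zspace_comb (T := T))).
  - exact: Zspace_dual.
  - exact: Zspace_separates.
  - by move=> f x Zf; exact: Zc.
split; first by split.
split; first by split.
split; first by split => // /i1_5.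
split; first by split => // /i5_4.
move=> refl; split.
  move=> h phi dphi; have [h5 [Zd _]] := i1_5 h.
  by apply: h5; exact: reflexive_Zspace.
by move=> h; apply: i3_1 => phi dphi; apply: norm_weakstar; exact: h.
Qed.

(** * The scalars R and R[i] *)

Section Scalars.
Variable R : realType.

Lemma archimedean_real : archimedean_scalars R.
Proof. by move=> x x0; exists (Num.truncn x).+1; rewrite ltW// truncnS_gt. Qed.

Lemma cauchy_complete_banach (K : numFieldType) (X : completeNormedModType K) :
  cauchy_complete X.
Proof. by move=> u; exact: cauchy_cvg. Qed.

Local Open Scope complex_scope.

Lemma archimedean_complex : archimedean_scalars R[i].
Proof.
move=> x x0; have xE : (complex.Re x)%:C = x by rewrite RRe_real ?ger0_real.
have [|n xn] := @archimedean_real (complex.Re x); first by rewrite -ler0c xE.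
by exists n; rewrite -xE -(rmorph_nat (real_complex R)) lecR.
Qed.

Lemma norm_Re_le (z : R[i]) : `|complex.Re z|%:C <= `|z|.
Proof.
by rewrite normc_def lecR -sqrtr_sqr ler_wsqrtr// lerDl sqr_ge0.
Qed.

Lemma norm_Im_le (z : R[i]) : `|complex.Im z|%:C <= `|z|.
Proof.
by rewrite normc_def lecR -sqrtr_sqr ler_wsqrtr// lerDr sqr_ge0.
Qed.

Lemma norm_le_ReIm (z : R[i]) :
  `|z| <= (`|complex.Re z| + `|complex.Im z|)%:C.
Proof.
rewrite normc_def lecR -[leRHS]ger0_norm ?addr_ge0// -sqrtr_sqr ler_wsqrtr//.
rewrite sqrrD !real_normK ?num_real// -addrA lerD2l lerDr.
by rewrite mulrn_wge0// mulr_ge0.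
Qed.

Lemma cauchy_complete_complex : cauchy_complete (R[i]^o).
Proof.
move=> u cu.
(* Stated for any additive [p] that does not increase the norm, to serve both the real and the
   imaginary part. *)
have uR (p : R[i] -> R) : (forall z w, p (z - w) = p z - p w) ->
    (forall z, `|p z|%:C <= `|z|) -> cvg ((fun n => p (u n)) @ \oo).
  move=> pB pn; apply: (@cauchy_cvg R); apply/cauchyP => e e0.
  have e0C : 0 < e%:C by rewrite ltcR.
  have [x xu] := (cauchyP _).1 cu _ e0C; exists (p x).
  have {}xu : \forall n \near \oo, ball x e%:C (u n) by exact: xu.
  suff : \forall n \near \oo, ball (p x) e (p (u n)) by [].
  apply: filterS xu => n; rewrite -!ball_normE /= => xn.
  by rewrite -ltcR -pB; exact: le_lt_trans (pn _) xn.
have /cvg_ex [a /= ua] := uR (@complex.Re R)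
  (fun '(_ +i* _) '(_ +i* _) => erefl)  norm_Re_le.
have /cvg_ex [b /= ub] := uR (@complex.Im R)
  (fun '(_ +i* _) '(_ +i* _) => erefl)  norm_Im_le.
apply/cvg_ex; exists (a +i* b); apply/cvgrPdist_le => e e0.
have eE : e = (complex.Re e)%:C by rewrite RRe_real ?gtr0_real.
have e20 : 0 < complex.Re e / 2 by rewrite divr_gt0// -ltcR -eE.
near=> n; apply: le_trans (norm_le_ReIm _) _; rewrite eE lecR [leRHS]splitr.
have -> : complex.Re (a +i* b - u n) = a - complex.Re (u n) by case: (u n).
have -> : complex.Im (a +i* b - u n) = b - complex.Im (u n) by case: (u n).
apply: lerD; near: n.
  by move/cvgrPdist_le : ua; exact.
by move/cvgrPdist_le : ub; exact.
Unshelve. all: by end_near. Qed.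

End Scalars.

(* Real case: scalars R; complex case: scalars R[i]. X ranges over Banach spaces. *)
Theorem theorem2p1 (R : realType) :
  (forall X : completeNormedModType R, @theorem2p1_statement R X) /\
  (forall X : completeNormedModType R[i], @theorem2p1_statement R[i] X).
Proof.
split=> X; apply: theorem2p1_generic.
- exact: archimedean_real.
- exact: (@cauchy_complete_banach R R^o).
- exact: hahn_banach_real.
- exact: cauchy_complete_banach.
- exact: archimedean_complex.
- exact: cauchy_complete_complex.
- exact: hahn_banach_complex.
- exact: cauchy_complete_banach.
Qed.
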